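(* Let $F=(f_1,\dots,f_m)$ be the autonomous Riccati hierarchy (with $c=1$) on $\mathbb{C}^m$, $$f_i(x)=x_{i+1}-x_1x_i\ (1\le i\le m-1),\qquad f_m(x)=-x_1x_m ,$$ and define $G=(g_1,\dots,g_m)$ by $$g_i=x_ix_m\ (1\le i\le m-1),\qquad g_m=x_m^2 .$$ Then $G$ commutes with $F$, i.e. $[F,G]=0$. Moreover, $G$ is nontrivial: it is not a scalar multiple of $F$, and it is quasi-homogeneous of degree $\gamma=m$.
   Context: Here $m\in\mathbb{N}$. For polynomial vector fields $F=(f_1,\dots,f_m)$ and $G=(g_1,\dots,g_m)$ on $\mathbb{C}^m$, the commutator is $$[F,G]_i=\sum_{j=1}^m\bigl(f_j\,\partial_{x_j}g_i-g_j\,\partial_{x_j}f_i\bigr),\qquad i=1,\dots,m .$$ With weights $\mathrm{wt}(x_i)=i$, the vector field $G$ is quasi-homogeneous of degree $\gamma\in\mathbb{N}$ if $$g_i(\lambda x_1,\lambda^2x_2,\dots,\lambda^mx_m)=\lambda^{i+\gamma}g_i(x),\qquad \lambda\in\mathbb{C},\ i=1,\dots,m .$$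
   Formalization: The claim that G is not a scalar multiple of F is stated only for m ≥ 2, because for m = 1 one has f_1 = −x_1² and g_1 = x_1², so G = −F; the other claims are stated for all m ≥ 1. *)

(* Defs.v *)
From mathcomp Require Import all_boot all_order all_algebra.
From mathcomp Require Import mpoly.

Set Implicit Arguments.
Unset Strict Implicit.
Unset Printing Implicit Defensive.

Import GRing.Theory.
Local Open Scope ring_scope.

Notation pvfield K m := {ffun 'I_m -> {mpoly K[m]}} (only parsing).

Definition commutator (K : fieldType) (m : nat) (F G : pvfield K m) :
    pvfield K m :=
  [ffun i => \sum_(j < m) (F j * (G i)^`M(j) - G j * (F i)^`M(j))].

(* Coordinates are indexed from 0: the coordinate of weight k is 'X_(k - 1),
   so i : 'I_m has weight i.+1. *)
Definition quasi_homogeneous (K : fieldType) (m gamma : nat)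
    (G : pvfield K m) : Prop :=
  forall (lambda : K) (x : 'I_m -> K) (i : 'I_m),
    (G i).@[fun j => lambda ^+ j.+1 * x j]
      = lambda ^+ (i.+1 + gamma) * (G i).@[x].

(* Dimension n.+1, so that the first and last coordinates are ord0, ord_max. *)
Definition riccati (K : fieldType) (n : nat) : pvfield K n.+1 :=
  [ffun i : 'I_n.+1 =>
    if i == ord_max then - ('X_ord0 * 'X_ord_max)
    else 'X_(inord i.+1) - 'X_ord0 * 'X_i].

(* In dimension 1 (n = 0) this is the opposite of riccati. *)
Definition riccati_symmetry (K : fieldType) (n : nat) : pvfield K n.+1 :=
  [ffun i : 'I_n.+1 =>
    if i == ord_max then 'X_ord_max ^+ 2 else 'X_i * 'X_ord_max].

(* Main.v *)
Require Import Defs.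
From mathcomp Require Import all_boot all_order all_algebra.
From mathcomp Require Import reals.
From mathcomp Require Import complex.
From mathcomp Require Import mpoly.
From mathcomp Require Import ring.

Import GRing.Theory.
Local Open Scope ring_scope.

(** Write [E] for the Euler field [sum_j x_j d_j], and [N] for the linear field
    whose components are the shifted coordinates [x_(i+1)], with [0] in the
    last place.  Then [F = N - x_1 E] and [G = x_m E].  Acting as derivations,
    [F] sends [x_m] to [- x_1 x_m], because [N] kills [x_m], whereas [E]
    multiplies a homogeneous polynomial by its degree.  On the [i]-th
    coordinate this gives
    [F (x_m x_i) = x_m N_i - 2 x_1 x_m x_i] and
    [G (N_i - x_1 x_i) = x_m (N_i - 2 x_1 x_i)],
    which agree: the commutator vanishes ([riccati_symmetry_commutes]).

    If [G = c F] in dimension at least two, the first components at the point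
    [(1, 0, ..., 0)] read [0 = - c], while at [(1, ..., 1)] the first component
    of [G] is [1] ([riccati_symmetry_not_scalar]).

    The weights of [x_i] and [x_m] add up to [i + m], which is the
    quasi-homogeneity of degree [m] ([riccati_symmetry_quasi_homogeneous]). *)

Definition lie {K : fieldType} {m : nat} (V : pvfield K m) (p : {mpoly K[m]}) :
    {mpoly K[m]} :=
  \sum_(j < m) V j * p^`M(j).

Section Lie.

Variables (K : fieldType) (m : nat).
Implicit Types (V : pvfield K m) (p q : {mpoly K[m]}).

Lemma lie0 V : lie V 0 = 0.
Proof. by rewrite /lie big1 // => j _; rewrite linear0 mulr0. Qed.

Lemma lieB V p q : lie V (p - q) = lie V p - lie V q.
Proof.
by rewrite /lie -sumrB; apply: eq_bigr => j _; rewrite linearB mulrBr.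
Qed.

Lemma lieM V p q : lie V (p * q) = lie V p * q + p * lie V q.
Proof.
rewrite /lie mulr_suml mulr_sumr -big_split /=; apply: eq_bigr => j _.
by rewrite mderivM; ring.
Qed.

Lemma lieX V i : lie V 'X_i = V i.
Proof.
rewrite /lie (bigD1 i) //= big1 => [|j neq_ji]; last first.
  by rewrite mderivX mnm1E eq_sym (negbTE neq_ji) scale0r mulr0.
by rewrite mderivX mnm1E eqxx -{1}[U_(i)%MM]add0m addmK scale1r mpolyX0 mulr1 addr0.
Qed.

Lemma commutatorE V W i : commutator V W i = lie V (W i) - lie W (V i).
Proof. by rewrite ffunE sumrB. Qed.

End Lie.

Section Riccati.

Variables (K : fieldType) (n : nat).
Local Notation F := (riccati K n).
Local Notation G := (riccati_symmetry K n).

Definition shift_coord (i : 'I_n.+1) : {mpoly K[n.+1]} :=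
  if i == ord_max then 0 else 'X_(inord i.+1).

Lemma riccatiE i : F i = shift_coord i - 'X_ord0 * 'X_i.
Proof. by rewrite ffunE /shift_coord; case: eqP => // ->; rewrite sub0r. Qed.

Lemma riccati_symmetryE i : G i = 'X_ord_max * 'X_i.
Proof. by rewrite ffunE; case: eqP => [->|_]; rewrite ?expr2 // mulrC. Qed.

(** The shifted coordinates are homogeneous of degree one, hence fixed by the
    Euler field; [G] is the Euler field multiplied by the last coordinate. *)
Lemma lie_symmetry_shift i :
  lie G (shift_coord i) = 'X_ord_max * shift_coord i.
Proof.
rewrite /shift_coord; case: eqP => _; first by rewrite lie0 mulr0.
by rewrite lieX riccati_symmetryE.
Qed.

Lemma riccati_symmetry_commutes : commutator F G = 0.
Proof.
apply/ffunP => i; rewrite commutatorE [RHS]ffunE.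
rewrite riccati_symmetryE riccatiE lieB !lieM !lieX lie_symmetry_shift.
rewrite !riccati_symmetryE !riccatiE.
have -> : shift_coord ord_max = 0 by rewrite /shift_coord eqxx.
by ring.
Qed.

Lemma riccati_symmetry_not_scalar :
  (0 < n)%N -> ~ (exists c : K, G = c *: F).
Proof.
move=> n_gt0 [c /ffunP /(_ ord0)].
rewrite [RHS]ffunE riccati_symmetryE riccatiE => eqG.
have max_neq0 : (ord_max == ord0 :> 'I_n.+1) = false.
  by rewrite -val_eqE /= eqn0Ngt n_gt0.
have c0 : c = 0.
  move/(congr1 (meval (fun j => (j == ord0)%:R))): eqG.
  rewrite mevalZ mevalB !mevalM /shift_coord eq_sym max_neq0 !mevalXU.
  rewrite max_neq0 eqxx -val_eqE /= inordK //= mul0r mul1r sub0r mulrN1.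
  by move/eqP; rewrite eq_sym oppr_eq0 => /eqP.
move/(congr1 (meval (fun=> 1))): eqG.
rewrite c0 scale0r meval0 mevalM !mevalXU mul1r.
by move/eqP; rewrite oner_eq0.
Qed.

Lemma riccati_symmetry_quasi_homogeneous : quasi_homogeneous n.+1 G.
Proof.
move=> lambda x i; rewrite riccati_symmetryE !mevalM !mevalXU exprD /=.
by ring.
Qed.

End Riccati.

Theorem proposition4p1 (R : realType) (n : nat) :
  let m := n.+1 in
  let F : pvfield R[i] m := riccati R[i] n in
  let G : pvfield R[i] m := riccati_symmetry R[i] n in
  [/\ commutator F G = 0,
      (1 < m)%N -> ~ (exists c : R[i], G = c *: F)
    & quasi_homogeneous m G].
Proof.
split; first exact: riccati_symmetry_commutes.
- exact: riccati_symmetry_not_scalar.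
- exact: riccati_symmetry_quasi_homogeneous.
Qed.
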